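(* Let $\mathfrak h_0$ be a Hilbert space, let $0<n_{\mathtt i}<n$ be integers and put $n_{\mathtt e}=n-n_{\mathtt i}$. Let $S\in\mathfrak B(\mathfrak h_0)^{n\times n}$ be unitary, let $L$ be a column vector of length $n$ with entries in $\mathfrak B(\mathfrak h_0)$, let $H=H^\dagger\in\mathfrak B(\mathfrak h_0)$, and let $$\mathbb V=\begin{pmatrix} 1 & -L^\dagger S & -\tfrac12L^\dagger L-iH \\ 0 & S & L \\ 0 & 0 & 1 \end{pmatrix}\in\mathfrak B(\mathfrak h_0)^{(1+n+1)\times(1+n+1)},$$ with rows and columns indexed by $0$, $\{1,\dots,n\}$, $0'$, and with $\{1,\dots,n\}$ split into an external group $\mathtt e$ (the first $n_{\mathtt e}$ indices) and an internal group $\mathtt i$ (the last $n_{\mathtt i}$ indices), so that $\mathbb V$ has blocks $V_{\alpha\beta}$ with $\alpha,\beta\in\{0,\mathtt e,\mathtt i,0'\}$. Let $D=\{X\in\mathbb C^{n_{\mathtt i}\times n_{\mathtt i}}: 1-V_{\mathtt{ii}}X\text{ is invertible}\}$ and let $\Phi:D\to\mathfrak B(\mathfrak h_0)^{(1+n_{\mathtt e}+1)\times(1+n_{\mathtt e}+1)}$ be the map whose value at $X$ has blocks $$\Phi(X)_{\alpha\beta}=V_{\alpha\beta}+V_{\alpha\mathtt i}X(1-V_{\mathtt{ii}}X)^{-1}V_{\mathtt i\beta},\qquad \alpha,\beta\in\{0,\mathtt e,0'\}.$$ Then for all $X,Y\in D$, $$\Phi(X)^\star\Phi(Y)=\mathbb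 I_{n_{\mathtt e}}+\begin{pmatrix} V_{\mathtt i0} & V_{\mathtt{ie}} & V_{\mathtt i0'} \end{pmatrix}^\star(1-X^\dagger V_{\mathtt{ii}}^\dagger)^{-1}(X^\dagger Y-1)(1-V_{\mathtt{ii}}Y)^{-1}\begin{pmatrix} V_{\mathtt i0} & V_{\mathtt{ie}} & V_{\mathtt i0'} \end{pmatrix},$$ $$\Phi(X)\Phi(Y)^\star=\mathbb I_{n_{\mathtt e}}+\begin{pmatrix} V_{0\mathtt i} \\ V_{\mathtt{ei}} \\ V_{0'\mathtt i} \end{pmatrix}(1-XV_{\mathtt{ii}})^{-1}(XY^\dagger-1)(1-V_{\mathtt{ii}}^\dagger Y^\dagger)^{-1}\begin{pmatrix} V_{0\mathtt i} \\ V_{\mathtt{ei}} \\ V_{0'\mathtt i} \end{pmatrix}^\star.$$ In particular, $\Phi$ maps unitaries in $D$ to $\star$-unitaries.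
   Context: $\mathfrak B(\mathfrak h_0)$ is the algebra of bounded operators on $\mathfrak h_0$; for a matrix of operators, $\dagger$ is the conjugate transpose (transpose the array and take operator adjoints of the entries). A matrix in $\mathbb C^{m\times m}$ is regarded as a matrix over $\mathfrak B(\mathfrak h_0)$ by identifying scalars with multiples of the identity; $1$ also denotes the identity matrix of the relevant size. For $m\ge1$ let $$\mathbb I_m=\begin{pmatrix} 1 & 0 & 0 \\ 0 & I_m & 0 \\ 0 & 0 & 1 \end{pmatrix},\qquad \mathbb J_m=\begin{pmatrix} 0 & 0 & 1 \\ 0 & I_m & 0 \\ 1 & 0 & 0 \end{pmatrix},$$ with $I_m$ the $m\times m$ identity. The $\star$-involution of $\mathbb X\in\mathfrak B(\mathfrak h_0)^{(1+m+1)\times(1+m+1)}$ is $\mathbb X^\star=\mathbb J_m\mathbb X^\dagger\mathbb J_m$, and $\mathbb X$ is $\star$-unitary if $\mathbb X\mathbb X^\star=\mathbb X^\star\mathbb X=\mathbb I_m$. For the rectangular blocks in the theorem, the factor $\mathbb J$ acts only on the side of size $1+n_{\mathtt e}+1$: $$\begin{pmatrix} V_{\mathtt i0} & V_{\mathtt{ie}} & V_{\mathtt i0'} \end{pmatrix}^\star=\mathbb J_{n_{\mathtt e}}\begin{pmatrix} V_{\mathtt i0} & V_{\mathtt{ie}} & V_{\mathtt i0'} \end{pmatrix}^\dagger=\begin{pmatrix} V_{\mathtt i0'}^\dagger \\ V_{\mathtt{ie}}^\dagger \\ V_{\mathtt i0}^\dagger \end{pmatrix},\qquad \begin{pmatrix}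 V_{0\mathtt i} \\ V_{\mathtt{ei}} \\ V_{0'\mathtt i} \end{pmatrix}^\star=\begin{pmatrix} V_{0\mathtt i} \\ V_{\mathtt{ei}} \\ V_{0'\mathtt i} \end{pmatrix}^\dagger\mathbb J_{n_{\mathtt e}}=\begin{pmatrix} V_{0'\mathtt i}^\dagger & V_{\mathtt{ei}}^\dagger & V_{0\mathtt i}^\dagger \end{pmatrix}.$$ In block form, $V_{00}=V_{0'0'}=1$, $V_{\mathtt e0}=V_{\mathtt i0}=V_{0'0}=V_{0'\mathtt e}=V_{0'\mathtt i}=0$, $V_{00'}=-\tfrac12L^\dagger L-iH$, $[V_{0\mathtt e}\ V_{0\mathtt i}]=-L^\dagger S$, $V_{ab}=S_{ab}$ and $V_{a0'}=L_a$ for $a,b\in\{\mathtt e,\mathtt i\}$. *)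

(* Defs.v *)
From HB Require Import structures.
From mathcomp Require Import all_boot all_order all_algebra.
From mathcomp Require Import complex.
From mathcomp Require Import mathcomp_extra boolp classical_sets functions reals.
From mathcomp Require Import topology normedtype.

Set Implicit Arguments.
Unset Strict Implicit.
Unset Printing Implicit Defensive.
Import Order.TTheory GRing.Theory Num.Theory.
Import numFieldNormedType.Exports.
Local Open Scope classical_set_scope.
Local Open Scope ring_scope.
Local Open Scope sesquilinear_scope.

(* The inner product is linear in its first argument and conjugate-linear in
   the second one. *)
HB.mixin Record isHilbert (R : realType) h of CompleteNormedModule R[i] h := {
  inner : {dot h for (@Num.conj R[i])};
  normr_inner : forall x : h, `|x| ^+ 2 = inner x x }.

#[short(type="hilbertType")]
HB.structure Definition Hilbert (R : realType) :=
  {h of isHilbert R h & CompleteNormedModule R[i] h}.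

Section BoundedOperators.
Variables (R : realType) (h : hilbertType R).

Definition bounded_op : {pred h -> h} :=
  [pred f : h -> h | `[< linear f /\ exists M, forall x, `|f x| <= M * `|x| >]].

Lemma bounded_opP (f : h -> h) :
  reflect (linear f /\ exists M, forall x, `|f x| <= M * `|x|)
          (f \in bounded_op).
Proof. exact: asboolP. Qed.

Lemma bounded_op_submod : GRing.submod_closed bounded_op.
Proof.
split=> [|a f g].
  apply/bounded_opP; split=> [b x y|]; first by rewrite scaler0 addr0.
  by exists 0 => x; rewrite mul0r normr0.
move=> /bounded_opP[linf [M fM]] /bounded_opP[ling [N gN]]; apply/bounded_opP.
have fgE x : (a *: f + g) x = a *: f x + g x by [].
split=> [b x y|]; first rewrite !fgE linf ling !scalerDr !scalerA mulrC.
  by rewrite addrACA.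
exists (`|a| * M + N) => x; rewrite fgE (le_trans (ler_normD _ _))//.
by rewrite mulrDl lerD// normrZ -mulrA ler_wpM2l.
Qed.

HB.instance Definition _ :=
  GRing.isSubmodClosed.Build R[i] (h -> h) bounded_op bounded_op_submod.

Record bop := Bop { bop_fun :> h -> h; _ : bop_fun \in bounded_op }.

HB.instance Definition _ := [isSub for bop_fun].
HB.instance Definition _ := [Choice of bop by <:].
HB.instance Definition _ := [SubChoice_isSubLmodule of bop by <:].

Lemma bop_linear (f : bop) : linear f.
Proof. by have /bounded_opP[] := valP f. Qed.

Lemma bop_bounded (f : bop) : exists M, forall x, `|f x| <= M * `|x|.
Proof. by have /bounded_opP[] := valP f. Qed.

HB.instance Definition _ (f : bop) :=
  GRing.isLinear.Build R[i] h h *:%R (bop_fun f) (bop_linear f).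

Lemma bopP (f g : bop) : f =1 g -> f = g.
Proof. by move=> fg; apply/val_inj/funext. Qed.

Fact bop1_subproof : (@idfun h) \in bounded_op.
Proof.
by apply/bounded_opP; split=> //; exists 1 => x; rewrite mul1r.
Qed.

Fact bop_comp_subproof (f g : bop) : (f : h -> h) \o g \in bounded_op.
Proof.
apply/bounded_opP; split=> [a x y|]; first by rewrite /= !linearP.
have [M fM] := bop_bounded f; have [N gN] := bop_bounded g.
have [h0|/existsNP[z /eqP z0]] := pselect (forall x : h, x = 0).
  by exists 0 => x; rewrite (h0 x) (h0 ((_ \o _) 0)) normr0 mulr0.
have M0 : 0 <= M.
  by rewrite -(pmulr_lge0 _ (_ : 0 < `|z|)) ?normr_gt0// (le_trans _ (fM z)).
exists (M * N) => x; rewrite /= (le_trans (fM _))// -mulrA ler_wpM2l//.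
Qed.

Definition bop1 := Bop bop1_subproof.
Definition bop_comp (f g : bop) := Bop (bop_comp_subproof f g).

Fact bop_compA : associative bop_comp. Proof. by move=> *; apply: bopP. Qed.
Fact bop_comp1l : left_id bop1 bop_comp. Proof. by move=> *; apply: bopP. Qed.
Fact bop_comp1r : right_id bop1 bop_comp. Proof. by move=> *; apply: bopP. Qed.
Fact bop_compDl : left_distributive bop_comp +%R.
Proof. by move=> *; apply: bopP. Qed.
Fact bop_compDr : right_distributive bop_comp +%R.
Proof. by move=> f ? ?; apply: bopP => x; apply: (linearD f). Qed.

HB.instance Definition _ := GRing.Zmodule_isPzRing.Build bop
  bop_compA bop_comp1l bop_comp1r bop_compDl bop_compDr.

(* h may be the zero space, so 'B(h) is not declared as an algType, which would
   require 1 != 0. *)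
Lemma bop_scaleAl (a : R[i]) (f g : bop) : a *: (f * g) = (a *: f) * g.
Proof. exact: bopP. Qed.
Lemma bop_scaleAr (a : R[i]) (f g : bop) : a *: (f * g) = f * (a *: g).
Proof. by apply: bopP => x; apply/esym/linearZZ. Qed.

(* The adjoint exists by the Riesz representation theorem and is unique. *)
Definition adj (f : bop) : bop :=
  xget 0 [set g : bop | forall x y, inner (f x) y = inner x (g y)].

End BoundedOperators.

Notation "''B' ( h )" := (bop h) (at level 8, format "''B' ( h )") : type_scope.

Section OperatorMatrices.
Variables (R : realType) (h : hilbertType R).

Definition dagger m n (A : 'M['B(h)]_(m, n)) : 'M['B(h)]_(n, m) :=
  (map_mx (@adj R h) A)^T.

Definition scmx m n (X : 'M[R[i]]_(m, n)) : 'M['B(h)]_(m, n) :=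
  map_mx (fun c => c *: (1 : 'B(h))) X.

Definition is_inverse m (A B : 'M['B(h)]_m) :=
  A *m B = 1%:M /\ B *m A = 1%:M.

Definition invertible m (A : 'M['B(h)]_m) := exists B, is_inverse A B.

(* Equal to 0 when A is not invertible. *)
Definition inverse m (A : 'M['B(h)]_m) : 'M['B(h)]_m :=
  xget 0 [set B | is_inverse A B].

Definition unitary_op m (A : 'M['B(h)]_m) := is_inverse A (dagger A).

Definition Jmx m : 'M['B(h)]_(1 + m + 1) :=
  block_mx (block_mx 0 0 0 1%:M) (col_mx 1%:M 0) (row_mx 1%:M 0) 0.

Definition star m (A : 'M['B(h)]_(1 + m + 1)) : 'M['B(h)]_(1 + m + 1) :=
  Jmx m *m dagger A *m Jmx m.

Definition star_row p m (A : 'M['B(h)]_(p, 1 + m + 1)) :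
  'M['B(h)]_(1 + m + 1, p) := Jmx m *m dagger A.

Definition star_col p m (A : 'M['B(h)]_(1 + m + 1, p)) :
  'M['B(h)]_(p, 1 + m + 1) := dagger A *m Jmx m.

Definition star_unitary m (A : 'M['B(h)]_(1 + m + 1)) :=
  A *m star A = 1%:M /\ star A *m A = 1%:M.

(* Rows and columns are ordered 0, 1, ..., n, 0'. *)
Definition Vmx n (S : 'M['B(h)]_n) (L : 'cV['B(h)]_n) (H : 'B(h)) :
    'M['B(h)]_(1 + n + 1) :=
  block_mx
    (block_mx 1%:M (- (dagger L *m S)) 0 S)
    (col_mx (- (2^-1 : R[i]) *: (dagger L *m L) 0 0 - ('i : R[i]) *: H)%:M L)
    0 1%:M.

End OperatorMatrices.

(* labe and labi label the first ne and the last ni indices of 1, ..., ne + ni. *)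
Variant label := lab0 | labe | labi | lab0'.

Section Blocks.
Variables (R : realType) (h : hilbertType R) (ne ni : nat).

Definition bsize (a : label) : nat :=
  match a with labe => ne | labi => ni | lab0 | lab0' => 1 end.

Definition bindex (a : label) : 'I_(bsize a) -> 'I_(1 + (ne + ni) + 1) :=
  match a with
  | lab0 => fun k : 'I_1 => lshift 1 (lshift (ne + ni) k)
  | labe => fun k : 'I_ne => lshift 1 (rshift 1 (lshift ni k))
  | labi => fun k : 'I_ni => lshift 1 (rshift 1 (rshift ne k))
  | lab0' => fun k : 'I_1 => rshift (1 + (ne + ni)) k
  end.

Variable V : 'M['B(h)]_(1 + (ne + ni) + 1).

Definition blk (a b : label) : 'M['B(h)]_(bsize a, bsize b) :=
  mxsub (bindex (a := a)) (bindex (a := b)) V.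

Definition Vi_ : 'M['B(h)]_(ni, 1 + ne + 1) :=
  row_mx (row_mx (blk labi lab0) (blk labi labe)) (blk labi lab0').

Definition V_i : 'M['B(h)]_(1 + ne + 1, ni) :=
  col_mx (col_mx (blk lab0 labi) (blk labe labi)) (blk lab0' labi).

(* Rows and columns ordered 0, e, 0'. *)
Definition assemble (F : forall a b, 'M['B(h)]_(bsize a, bsize b)) :
    'M['B(h)]_(1 + ne + 1) :=
  block_mx
    (block_mx (F lab0 lab0) (F lab0 labe) (F labe lab0) (F labe labe))
    (col_mx (F lab0 lab0') (F labe lab0'))
    (row_mx (F lab0' lab0) (F lab0' labe)) (F lab0' lab0').

Definition Phi_dom : set 'M[R[i]]_ni :=
  [set X | invertible (1%:M - blk labi labi *m scmx h X)].

Definition Phi (X : 'M[R[i]]_ni) : 'M['B(h)]_(1 + ne + 1) :=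
  assemble (fun a b => blk a b +
    blk a labi *m scmx h X
      *m inverse (1%:M - blk labi labi *m scmx h X) *m blk labi b).

End Blocks.

(* Main.v *)
(* The matrix V satisfies V^dagger J V = J = V J V^dagger. Splitting the indices
   into x = (0, e, 0') and i, with A = V_xx, B = V_xi, C = V_ix and D = V_ii,
   the first equation gives A^dagger J A + C^dagger C = J,
   A^dagger J B + C^dagger D = 0 and B^dagger J B + D^dagger D = 1, and the
   second one gives the analogous relations with the daggers on the right.
   Since Phi(X) = A + B X (1 - D X)^-1 C = A + B (1 - X D)^-1 X C, expanding
   Phi(X)^dagger J Phi(Y) and Phi(X) J Phi(Y)^dagger and eliminating A and B,
   respectively A and C, yields both identities. *)

Require Import Defs.
From HB Require Import structures.
From mathcomp Require Import all_boot all_order all_algebra.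
From mathcomp Require Import complex.
From mathcomp Require Import mathcomp_extra boolp classical_sets functions reals.
From mathcomp Require Import topology normedtype.
From mathcomp Require Import ring lra.

Set Implicit Arguments.
Unset Strict Implicit.
Unset Printing Implicit Defensive.
Import Order.TTheory GRing.Theory Num.Theory.
Import numFieldNormedType.Exports.
Local Open Scope classical_set_scope.
Local Open Scope ring_scope.
Local Open Scope sesquilinear_scope.

(** * Riesz representation and adjoints *)

Section Riesz.
Variables (R : realType) (h : hilbertType R).
Implicit Types (x y z v : h) (a : R[i]).

Lemma innerC x y : inner x y = (inner y x)^*.
Proof. by rewrite hermC expr0 mul1r. Qed.

Lemma innerZl a x y : inner (a *: x) y = a * inner x y.
Proof. exact: linearZl_LR. Qed.

Lemma innerZr a x y : inner x (a *: y) = a^* * inner x y.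
Proof. by rewrite innerC innerZl rmorphM/= -innerC. Qed.

Lemma inner_inj x y : (forall v, inner v x = inner v y) -> x = y.
Proof.
move=> xy; apply/eqP; rewrite -subr_eq0 -normr_eq0 -(sqrf_eq0 `|_|).
by rewrite normr_inner linearBr/= xy subrr.
Qed.

Lemma normB_inner x y :
  `|x - y| ^+ 2 = `|x| ^+ 2 + `|y| ^+ 2 - (inner x y + (inner x y)^*).
Proof.
rewrite !normr_inner linearBl !linearBr/= (innerC y x); ring.
Qed.

Lemma cauchy_schwarz x y : `|inner x y| <= `|x| * `|y|.
Proof.
have [->|y0] := eqVneq y 0; first by rewrite linear0r !normr0 mulr0.
rewrite -(@ler_pXn2r _ 2)// ?nnegrE ?mulr_ge0// exprMn.
have ny : 0 < `|y| ^+ 2 by rewrite exprn_gt0// normr_gt0.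
(* This vector is [|y|^2] times the component of [x] orthogonal to [y]; its squared norm is
   [|y|^2 (|x|^2 |y|^2 - |<x,y>|^2)]. *)
have : 0 <= `|(`|y| ^+ 2) *: x - inner x y *: y| ^+ 2 by rewrite exprn_ge0.
rewrite normB_inner !normrZ !exprMn innerZl innerZr.
rewrite !rmorphM/= conjCK (conj_Creal (normr_real y)) normr_id.
set a := `|y|; set b := `|x|; set c := `|inner x y|.
have -> : a ^+ 2 * a ^+ 2 * b ^+ 2 + c ^+ 2 * a ^+ 2 -
  (a ^+ 2 * ((inner x y)^* * inner x y) + a * a * (inner x y * (inner x y)^*))
  = a ^+ 2 * (b ^+ 2 * a ^+ 2 - c ^+ 2).
  by rewrite /c normCK; ring.
by rewrite pmulr_rge0// subr_ge0.
Qed.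

Local Notation Re := complex.Re.

Lemma Re_le (a b : R[i]) : a <= b -> Re a <= Re b.
Proof. by rewrite lecE => /andP[]. Qed.

Lemma Re_norm a : Re a <= Re `|a|.
Proof.
rewrite normc_def/=; case: a => a b /=.
rewrite (le_trans (ler_norm a))// -sqrtr_sqr ler_sqrt ?addr_ge0 ?sqr_ge0//.
by rewrite lerDl sqr_ge0.
Qed.

Lemma Re_conj a : Re a^* = Re a.
Proof. by case: a. Qed.

Lemma ge0_ReK a : 0 <= a -> (Re a)%:C%C = a.
Proof. by move=> /ger0_real /RRe_real. Qed.

Section RieszFunctional.
Variables (phi : h -> R[i]) (M : R[i]).
Hypothesis phiD : forall a x y, phi (a *: x + y) = a * phi x + phi y.
Hypothesis phi_bounded : forall x, `|phi x| <= M * `|x|.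

(* The Riesz vector is the minimizer of J: the parallelogram law makes the
   near-minimizers a Cauchy filter, and J (x + v) >= d for near-minimizers x
   passes to the limit as the first-order condition. *)
Let J x : R := Re (`|x| ^+ 2) - 2 * Re (phi x).
Let d := inf (range J).

(** Completing the square: with [n] the norm of [x] and [m = Re M],
    [J x >= n^2 - 2 m n >= - m^2]. *)
Let J_lb x : - Re M ^+ 2 <= J x.
Proof.
have nE : (Re `|x|)%:C%C = `|x| by apply: ge0_ReK.
have : Re (phi x) <= Re M * Re `|x|.
  apply: (le_trans (Re_norm _)); apply: (le_trans (Re_le (phi_bounded x))).
  by rewrite -nE; case: (M) => a b /=; rewrite mulr0 subr0.
rewrite /J -nE -rmorphXn/=.
move: (Re `|x|) (Re M) (Re _) => n m p pmn.
by have := sqr_ge0 (n - m); rewrite sqrrB; lra.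
Qed.

Let hasinfJ : has_inf (range J).
Proof.
by split; [exists (J 0), 0|exists (- Re M ^+ 2) => _ [x _ <-]; exact: J_lb].
Qed.

Let d_le x : d <= J x.
Proof. by apply: ge_inf; [case: hasinfJ|exists x]. Qed.

Let phi0 : phi 0 = 0.
Proof. by have := phiD (-1) 0 0; rewrite scaler0 addr0 mulN1r addNr. Qed.

Let phiZ a x : phi (a *: x) = a * phi x.
Proof. by have := phiD a x 0; rewrite phi0 !addr0. Qed.

Let phi_add x y : phi (x + y) = phi x + phi y.
Proof. by have := phiD 1 x y; rewrite scale1r mul1r. Qed.

(** The contributions of [phi] cancel by linearity, which leaves the parallelogram law. *)
Let J_parallelogram x y :
  Re (`|x - y| ^+ 2) = 2 * J x + 2 * J y - 4 * J (2^-1 *: (x + y)).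
Proof.
have E : `|x - y| ^+ 2 = 2%:R * `|x| ^+ 2 + 2%:R * `|y| ^+ 2 - `|x + y| ^+ 2.
  rewrite !normr_inner linearBl !linearBr/= !linearDl !linearDr/=; ring.
have E2 : `|2^-1 *: (x + y)| ^+ 2 = (4^-1)%:C%C * `|x + y| ^+ 2.
  rewrite normrZ exprMn ger0_norm ?invr_ge0 ?ler0n// exprVn -natrX.
  by rewrite fmorphV rmorph_nat.
rewrite /J E2 E phiZ phi_add.
have -> : (2^-1 : R[i]) = (2^-1)%:C%C by rewrite fmorphV rmorph_nat.
rewrite -!(rmorph_nat (@real_complex R)).
move: (`|x| ^+ 2) (`|y| ^+ 2) (`|x + y| ^+ 2) (phi x) (phi y).
by move=> [? ?] [? ?] [? ?] [? ?] [? ?] /=; field.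
Qed.

Let A (e : R) := [set x | J x < d + e].
Let F : set_system h := filter_from [set e : R | 0 < e] A.

(** The midpoint still has [J >= d], so the parallelogram identity leaves less than
    [4 (d + e) - 4 d]. *)
Let A_close e x y : A e x -> A e y -> Re (`|x - y| ^+ 2) < 4 * e.
Proof.
rewrite /A/= => Ax Ay; rewrite J_parallelogram.
have := d_le (2^-1 *: (x + y)); lra.
Qed.

Let F_proper : ProperFilter F.
Proof.
apply: filter_from_proper => [|e e0].
  apply: filter_from_filter; first by exists 1; rewrite /= ltr01.
  move=> e f e0 f0; exists (Num.min e f); first by rewrite /= lt_min e0.
  rewrite /A => x /= Ax; split; apply: (lt_le_trans Ax).
    by rewrite lerD2l ge_min lexx.
  by rewrite lerD2l ge_min lexx orbT.
by have [_ [x _ <-] xd] := inf_adherent e0 hasinfJ; exists x.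
Qed.

Let F_cauchy : cauchy F.
Proof.
have FF := F_proper; have {}FF : Filter F by exact _.
apply: cauchy_exP => eps eps0.
have epsE : (Re eps)%:C%C = eps by exact: ge0_ReK (ltW eps0).
have r0 : 0 < Re eps by rewrite -ltcR epsE.
(* At this level [A_close] bounds squared distances by [eps^2 / 2]. *)
have e0 : 0 < Re eps ^+ 2 / 8 by rewrite divr_gt0// exprn_gt0.
have [_ [x _ <-] xd] := inf_adherent e0 hasinfJ; exists x.
exists (Re eps ^+ 2 / 8) => // y Ay.
rewrite -ball_normE/= -(@ltr_pXn2r _ 2)// ?nnegrE//; last exact: ltW.
rewrite -epsE -(@ge0_ReK (`|_| ^+ 2)) ?exprn_ge0// -rmorphXn ltcR.
apply: (lt_trans (A_close xd Ay)); nra.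
Qed.

Let z := lim F.

Let first_order v : 0 <= Re (`|v| ^+ 2) + 2 * Re (inner v z) - 2 * Re (phi v).
Proof.
apply/ler_addgt0Pl => e e0.
have nE : (Re `|v|)%:C%C = `|v| by apply: ge0_ReK.
have n0 : 0 <= Re `|v| by have := normr_ge0 v; rewrite -nE ler0c.
set n := Re `|v| in nE n0.
(* Replacing [z] by a point [x] of this ball costs at most [e / 4] in [Re <v, z>], doubled to
   [e / 2]; the near-minimality of [x] costs the other [e / 2]. The [+ 1] covers [v = 0]. *)
pose del := e / (4 * (n + 1)).
have del0 : 0 < del by rewrite divr_gt0// mulr_gt0// ltr_wpDl.
have nz : nbhs z (ball z del%:C%C) by apply: nbhsx_ballx; rewrite ltcR.
have Fz : F --> z by exact: (@cauchy_cvg h F F_proper F_cauchy).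
have Ae : F (A (e / 2)) by exists (e / 2) => //; rewrite /= divr_gt0.
have FF := F_proper.
have [x [/= xz Ax]] := filter_ex (filterI (Fz _ nz) Ae).
move: xz Ax; rewrite -ball_normE /A/= => xz Ax.
have := d_le (x + v).
have bnd : Re (inner v (x - z)) <= n * del.
  apply: (le_trans (Re_norm _)); rewrite -lecR ge0_ReK//.
  rewrite (le_trans (cauchy_schwarz _ _))// -nE rmorphM ler_wpM2l ?lecR//.
  by rewrite distrC ltW.
have ndel : n * del <= e / 4.
  rewrite /del mulrA ler_pdivrMr ?mulr_gt0 ?ltr_wpDl//; nra.
move: Ax bnd.
have xvE : `|x + v| ^+ 2 =
    `|x| ^+ 2 + `|v| ^+ 2 + (inner v x + (inner v x)^*).
  by rewrite !normr_inner linearDl !linearDr/= (innerC x v); ring.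
rewrite linearBr/= /J phi_add xvE.
rewrite !raddfB !raddfD/= Re_conj.
lra.
Qed.

Lemma riesz_functional : exists z, forall x, phi x = inner x z.
Proof.
exists z => v; apply/eqP; rewrite -subr_eq0; set c := phi v - inner v z.
have nE : (Re (`|v| ^+ 2))%:C%C = `|v| ^+ 2.
  by apply: ge0_ReK; rewrite exprn_ge0.
have n0 : 0 <= Re (`|v| ^+ 2) by rewrite -lecR nE exprn_ge0.
set n := Re (`|v| ^+ 2) in nE n0.
have cE : (Re (`|c| ^+ 2))%:C%C = `|c| ^+ 2.
  by apply: ge0_ReK; rewrite exprn_ge0.
have c0 : 0 <= Re (`|c| ^+ 2) by rewrite -lecR cE exprn_ge0.
set m := Re (`|c| ^+ 2) in cE c0.
(* Chosen so that [t > 0] and [t n <= 1], even for [v = 0]; then [t m (t n - 2) >= 0] forces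
   [m <= 0]. *)
pose t := (n + 1)^-1.
have t0 : 0 < t by rewrite invr_gt0 ltr_wpDl.
have tn : t * n <= 1 by rewrite mulrC ler_pdivrMr ?ltr_wpDl//; lra.
(* Testing the first-order condition on a *: v gives t m (t n - 2) >= 0. *)
set a := t%:C%C * c^*.
have aE : `|a *: v| ^+ 2 = (t ^+ 2 * m * n)%:C%C.
  rewrite normrZ exprMn normrM norm_conjC exprMn ger0_norm ?ler0c ?ltW//.
  by rewrite 2!rmorphM/= rmorphXn cE nE.
have ac : inner (a *: v) z - phi (a *: v) = (- (t * m))%:C%C.
  rewrite phiZ innerZl -mulrBr -(opprB (phi v)) -/c mulrN rmorphN rmorphM/= cE.
  by rewrite normCK /a -mulrA [c^* * _]mulrC.
have := first_order (a *: v).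
rewrite -addrA -mulrBr -raddfB/= ac aE/= => H.
have ? : (t * m) * (t * n) <= t * m by rewrite ler_piMr// mulr_ge0// ltW.
have m0 : m <= 0 by rewrite -(pmulr_rle0 _ t0); lra.
by rewrite -normr_eq0 -sqrf_eq0 -cE (_ : m = 0)//; apply/eqP; rewrite eq_le m0.
Qed.

End RieszFunctional.

Implicit Types (f g : 'B(h)).

(** [g y] is the Riesz vector of the functional [<f x, y>] of [x], bounded by [M |y|]; linearity of
    [g] follows from the uniqueness of that vector. *)
Lemma adj_exists f : exists g, forall x y, inner (f x) y = inner x (g y).
Proof.
have [M fM] := bop_bounded f.
have /choice[g gE] y : exists z, forall x, inner (f x) y = inner x z.
  apply: (@riesz_functional _ (M * `|y|)) => [a x x'|x].
    by rewrite linearP linearPl.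
  rewrite (le_trans (cauchy_schwarz _ _))// mulrAC.
  by rewrite ler_wpM2r.
have g_lin : linear g.
  by move=> a y y'; apply: inner_inj => v; rewrite linearPr/= -!gE linearPr.
have g_bounded : exists M, forall y, `|g y| <= M * `|y|.
  (* Divide [|g y|^2 = <f (g y), y> <= M |g y| |y|] by [|g y|]. When [g y = 0], no sign of [M] is
     known and [0 <= |f y| <= M |y|] serves instead. *)
  exists M => y; have [->|gy0] := eqVneq (g y) 0.
    have [->|y0] := eqVneq y 0; first by rewrite !normr0 mulr0.
    by rewrite normr0 (le_trans _ (fM y)).
  rewrite -(@ler_pM2l _ `|g y|) ?normr_gt0// -expr2 normr_inner -gE.
  rewrite -[inner _ _]ger0_norm ?gE -?normr_inner ?exprn_ge0// normr_inner -gE.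
  rewrite (le_trans (cauchy_schwarz _ _))// mulrCA mulrA.
  by rewrite ler_wpM2r.
have gB : g \in @bounded_op R h by apply/bounded_opP.
by exists (Bop gB).
Qed.

(** By existence, the [xget] in [adj] picks a genuine adjoint rather than an arbitrary default. *)
Lemma inner_adj f x y : inner (f x) y = inner x (adj f y).
Proof.
pose P (g : 'B(h)) := forall x y, inner (f x) y = inner x (g y).
exact: (xgetPex 0 (adj_exists f : exists g, P g)).
Qed.

Lemma adj_unique f g : (forall x y, inner (f x) y = inner x (g y)) -> adj f = g.
Proof.
by move=> fg; apply: bopP => y; apply: inner_inj => x; rewrite -inner_adj fg.
Qed.

Lemma bop_adjK : involutive (@adj R h).
Proof.
by move=> f; apply: adj_unique => x y; rewrite innerC -inner_adj -innerC.
Qed.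

Lemma bop_adjM f g : adj (f * g) = adj g * adj f.
Proof.
apply: adj_unique => x y.
exact: etrans (inner_adj f (g x) y) (inner_adj g x (adj f y)).
Qed.

Lemma bop_adjD f g : adj (f + g) = adj f + adj g.
Proof.
apply: adj_unique => x y; rewrite [LHS](linearDl inner) [RHS](linearDr inner)/=.
by rewrite !inner_adj.
Qed.

Lemma bop_adjZ a f : adj (a *: f) = a^* *: adj f.
Proof.
apply: adj_unique => x y; rewrite [LHS]innerZl [RHS]innerZr conjCK.
by rewrite inner_adj.
Qed.

Lemma bop_adj1 : adj (1 : 'B(h)) = 1.
Proof. exact: adj_unique. Qed.

Lemma bop_adj0 : adj (0 : 'B(h)) = 0.
Proof.
by apply: adj_unique => x y; rewrite [LHS]linear0l [RHS]linear0r.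
Qed.

Lemma bop_adjN f : adj (- f) = - adj f.
Proof. by rewrite -scaleN1r bop_adjZ rmorphN1 scaleN1r. Qed.

End Riesz.

(** * Linear fractional transformations of block matrices *)

Section BlockIdentity.
Variables (T : pzRingType) (p q : nat).

(** The primed blocks are independent variables, so that one computation serves both identities:
    they become the daggers of the unprimed blocks, or the other way round. *)
Lemma transfer_identity (J A A' : 'M[T]_p) (B C' : 'M[T]_(p, q))
    (B' C : 'M[T]_(q, p)) (D D' X' Y M N : 'M[T]_q) :
  A' *m J *m A + C' *m C = J -> A' *m J *m B + C' *m D = 0 ->
  B' *m J *m A + D' *m C = 0 -> B' *m J *m B + D' *m D = 1%:M ->
  M *m (1%:M - X' *m D') = 1%:M -> (1%:M - D *m Y) *m N = 1%:M ->
  (A' + C' *m (M *m X') *m B') *m J *m (A + B *m (Y *m N) *m C) =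
  J + C' *m (M *m (X' *m Y - 1%:M) *m N) *m C.
Proof.
move=> /(canRL (addrK _)) AA /(canRL (addrK _)) AB /(canRL (addrK _)) BA.
move=> /(canRL (addrK _)) BB MK NK.
rewrite sub0r in AB; rewrite sub0r in BA.
have -> : (A' + C' *m (M *m X') *m B') *m J *m (A + B *m (Y *m N) *m C) =
  A' *m J *m A + A' *m J *m B *m (Y *m N *m C) +
  (C' *m M *m X') *m (B' *m J *m A) +
  (C' *m M *m X') *m (B' *m J *m B) *m (Y *m N *m C).
  by rewrite !mulmxDl !mulmxDr !mulmxA !addrA.
rewrite AA AB BA BB.
(* This resolvent identity merges the terms [- C' C] and [- C' D Y N C] into [- C' N C]. *)
have NE : N = 1%:M + D *m (Y *m N).
  by rewrite -[1%:M]NK mulmxBl mul1mx mulmxA subrK.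
have -> : M *m (X' *m Y - 1%:M) *m N =
    - N - M *m X' *m D' + M *m X' *m (1%:M - D' *m D) *m (Y *m N).
  (* The splitting is arranged so that [M] cancels [1 - X' D'] and [N] cancels [1 - D Y], giving
     exactly the terms of the expansion. *)
  have -> : X' *m Y - 1%:M = - (1%:M - X' *m D')
      - X' *m D' *m (1%:M - D *m Y) + X' *m (1%:M - D' *m D) *m Y.
    rewrite !(mulmxBl, mulmxBr, mulmx1, mul1mx, mulmxA) !opprB.
    by rewrite [RHS]addrC (addrC (_ - 1%:M)) !subrKA.
  rewrite 2!(mulmxDr M) !(mulmxN M) MK.
  by rewrite !mulmxDl !mulNmx mul1mx -!mulmxA NK mulmx1.
rewrite {3}NE.
rewrite !(mulmxDl, mulmxDr, mulNmx, mulmxN, mulmx1, mul1mx, mulmxA) -!addrA.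
by rewrite opprD -!addrA.
Qed.

End BlockIdentity.

(** * Operator matrices *)

Section Dagger.
Variables (R : realType) (h : hilbertType R).

Lemma daggerK m n (A : 'M['B(h)]_(m, n)) : dagger (dagger A) = A.
Proof. by apply/matrixP => i j; rewrite !mxE bop_adjK. Qed.

Lemma daggerM m n p (A : 'M['B(h)]_(m, n)) (B : 'M['B(h)]_(n, p)) :
  dagger (A *m B) = dagger B *m dagger A.
Proof.
apply/matrixP => i j; rewrite !mxE.
rewrite (big_morph _ (@bop_adjD R h) (@bop_adj0 R h)).
by apply: eq_bigr => k _; rewrite !mxE bop_adjM.
Qed.

Lemma daggerD m n (A B : 'M['B(h)]_(m, n)) :
  dagger (A + B) = dagger A + dagger B.
Proof. by apply/matrixP => i j; rewrite !mxE bop_adjD. Qed.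

Lemma daggerN m n (A : 'M['B(h)]_(m, n)) : dagger (- A) = - dagger A.
Proof. by apply/matrixP => i j; rewrite !mxE bop_adjN. Qed.

Lemma dagger0 m n : dagger (0 : 'M['B(h)]_(m, n)) = 0.
Proof. by apply/matrixP => i j; rewrite !mxE bop_adj0. Qed.

Lemma dagger_scalar n (f : 'B(h)) : dagger (f%:M : 'M_n) = (adj f)%:M.
Proof.
apply/matrixP => i j; rewrite !mxE eq_sym.
by case: (i == j); rewrite ?mulr1n// !mulr0n bop_adj0.
Qed.

Lemma dagger1 n : dagger (1%:M : 'M['B(h)]_n) = 1%:M.
Proof. by rewrite dagger_scalar bop_adj1. Qed.

Lemma dagger_mxsub m n m' n' (f : 'I_m' -> 'I_m) (g : 'I_n' -> 'I_n)
  (A : 'M['B(h)]_(m, n)) : dagger (mxsub f g A) = mxsub g f (dagger A).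
Proof. by apply/matrixP => i j; rewrite !mxE. Qed.

Lemma dagger_block m1 m2 n1 n2 (A : 'M['B(h)]_(m1, n1))
    (B : 'M['B(h)]_(m1, n2)) (C : 'M['B(h)]_(m2, n1)) (D : 'M['B(h)]_(m2, n2)) :
  dagger (block_mx A B C D) =
  block_mx (dagger A) (dagger C) (dagger B) (dagger D).
Proof. by rewrite /dagger map_block_mx tr_block_mx. Qed.

Lemma dagger_col m1 m2 n (A : 'M['B(h)]_(m1, n)) (B : 'M['B(h)]_(m2, n)) :
  dagger (col_mx A B) = row_mx (dagger A) (dagger B).
Proof. by rewrite /dagger map_col_mx tr_col_mx. Qed.

Lemma dagger_scmx m n (X : 'M[R[i]]_(m, n)) : dagger (scmx h X) = scmx h (X^t*).
Proof. by apply/matrixP => i j; rewrite !mxE bop_adjZ bop_adj1. Qed.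

Lemma scmxM m n p (X : 'M[R[i]]_(m, n)) (Y : 'M[R[i]]_(n, p)) :
  scmx h (X *m Y) = scmx h X *m scmx h Y.
Proof.
apply/matrixP => i j; rewrite !mxE scaler_suml; apply: eq_bigr => k _.
by rewrite !mxE -scalerA -bop_scaleAl mul1r.
Qed.

Lemma scmxB m n (X Y : 'M[R[i]]_(m, n)) : scmx h (X - Y) = scmx h X - scmx h Y.
Proof. by apply/matrixP => i j; rewrite !mxE scalerBl. Qed.

Lemma scmx0 m n : scmx h (0 : 'M[R[i]]_(m, n)) = 0.
Proof. by apply/matrixP => i j; rewrite !mxE scale0r. Qed.

Lemma scmx1 n : scmx h (1%:M : 'M[R[i]]_n) = 1%:M.
Proof.
by apply/matrixP => i j; rewrite !mxE; case: (i == j);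
  rewrite ?scale1r ?scale0r.
Qed.

Lemma is_inverse_uniq m (A B C : 'M['B(h)]_m) :
  is_inverse A B -> is_inverse A C -> B = C.
Proof. by move=> [_ B1] [C1 _]; rewrite -[B]mulmx1 -C1 mulmxA B1 mul1mx. Qed.

Lemma inverseE m (A B : 'M['B(h)]_m) : is_inverse A B -> inverse A = B.
Proof.
move=> AB.
apply: (is_inverse_uniq _ AB).
exact: (xgetPex 0 (ex_intro (is_inverse A) B AB)).
Qed.

Lemma is_inverse_dagger m (A B : 'M['B(h)]_m) :
  is_inverse A B -> is_inverse (dagger A) (dagger B).
Proof. by case=> AB BA; split; rewrite -daggerM ?AB ?BA dagger1. Qed.

Lemma is_inverse_dagger_1B m n (A : 'M['B(h)]_(m, n)) (B : 'M['B(h)]_(n, m))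
    (N : 'M['B(h)]_m) :
  is_inverse (1%:M - A *m B) N ->
  is_inverse (1%:M - dagger B *m dagger A) (dagger N).
Proof.
by move=> /is_inverse_dagger; rewrite daggerD daggerN daggerM dagger1.
Qed.

(** Push-through identity [(1 - X D)^-1 X = X (1 - D X)^-1], with
    [(1 - X D)^-1 = 1 + X (1 - D X)^-1 D]. *)
Lemma is_inverse_swap m n (D : 'M['B(h)]_(m, n)) (X : 'M['B(h)]_(n, m))
    (N : 'M['B(h)]_m) :
  is_inverse (1%:M - D *m X) N ->
  is_inverse (1%:M - X *m D) (1%:M + X *m N *m D) /\
  (1%:M + X *m N *m D) *m X = X *m N.
Proof.
case=> DN ND; rewrite mulmxBl mul1mx in DN; rewrite mulmxBr mulmx1 in ND.
have NE : N = 1%:M + D *m X *m N by rewrite -DN subrK.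
have NE' : N = 1%:M + N *m (D *m X) by rewrite -ND subrK.
split; first split.
- rewrite mulmxBl mul1mx mulmxDr mulmx1 {1}NE.
  rewrite !mulmxDr !mulmxDl !mulmx1 !mulmxA.
  by rewrite addrK.
- rewrite mulmxBr mulmx1 mulmxDl mul1mx {1}NE'.
  rewrite !mulmxDr !mulmxDl !mulmx1 !mulmxA.
  by rewrite addrK.
by rewrite mulmxDl mul1mx {2}NE' mulmxDr mulmx1 !mulmxA.
Qed.

End Dagger.

(** * Preservation of the indefinite form J by the model matrix V *)

Definition mx_blockE := (mulmx_block, mul_block_col, mul_row_block, mul_col_row,
  mul_row_col, add_block_mx, add_col_mx, add_row_mx,
  (mulmx0, mul0mx, mulmx1, mul1mx, addr0, add0r)).

Section Vmx.
Variables (R : realType) (h : hilbertType R) (n : nat).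

Lemma Jmx_sqr : Jmx h n *m Jmx h n = 1%:M.
Proof.
by rewrite /Jmx !mx_blockE !scalar_mx_block col_mx0 row_mx0.
Qed.

Variables (S : 'M['B(h)]_n) (L : 'cV['B(h)]_n) (H : 'B(h)).
Hypotheses (S_unitary : unitary_op S) (H_selfadjoint : H = adj H).

Let k := - (2^-1 : R[i]) *: (dagger L *m L) 0 0 - ('i : R[i]) *: H.

(** The self-adjoint half [- L^dagger L / 2] is counted twice, while [- i H] is skew-adjoint and
    cancels. *)
Lemma Vmx_corner : k%:M + (adj k)%:M = - (dagger L *m L) :> 'M_1.
Proof.
apply/matrixP => i j; rewrite !ord1 [LHS]mxE ![_%:M _ _]mxE [RHS]mxE !mulr1n.
have LL : adj ((dagger L *m L) 0 0) = (dagger L *m L) 0 0.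
  have := congr1 (fun A : 'M_1 => A 0 0) (daggerM (dagger L) L).
  by rewrite daggerK !mxE.
rewrite /k bop_adjD bop_adjN !bop_adjZ LL -H_selfadjoint.
have -> : ((- 2^-1)^* = - 2^-1 :> R[i]).
  by rewrite rmorphN/= fmorphV rmorph_nat.
rewrite conjCi !scaleNr opprK addrACA addNr addr0 -opprD -scalerDl.
by rewrite -[2^-1]mul1r -splitr scale1r.
Qed.

Lemma Vmx_isometry : dagger (Vmx S L H) *m Jmx h n *m Vmx S L H = Jmx h n.
Proof.
have [_ SS] := S_unitary.
rewrite /Vmx -/k /Jmx !dagger_block dagger_col !dagger1 !dagger0.
rewrite dagger_scalar daggerN daggerM daggerK.
by rewrite !mx_blockE addrAC Vmx_corner !addNr subrr SS.
Qed.

Lemma Vmx_coisometry : Vmx S L H *m Jmx h n *m dagger (Vmx S L H) = Jmx h n.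
Proof.
have [SS _] := S_unitary.
rewrite /Vmx -/k /Jmx !dagger_block dagger_col !dagger1 !dagger0.
rewrite dagger_scalar daggerN daggerM daggerK.
(* The corner contains [L^dagger S S^dagger L], which collapses to [L^dagger L] before [Vmx_corner]
   applies. *)
rewrite !mx_blockE !mulNmx !mulmxN opprK !mulmxA -(mulmxA (dagger L)) SS.
by rewrite mulmx1 mul1mx addrAC Vmx_corner !addNr subrr.
Qed.

End Vmx.

(** * Splitting the indices into x = (0, e, 0') and i *)

Section Partition.
Variables (R : realType) (h : hilbertType R) (ne ni : nat).

(** The embedding that skips the internal group, so that the blocks relative to x and i are plain
    [mxsub] of the full matrix. *)
Definition xindex (i : 'I_(1 + ne + 1)) : 'I_(1 + (ne + ni) + 1) :=
  match fintype.split i with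
  | inl j => match fintype.split j with
    | inl k => @bindex ne ni lab0 k
    | inr k => @bindex ne ni labe k
    end
  | inr k => @bindex ne ni lab0' k
  end.

Local Notation iindex := (@bindex ne ni labi).
Implicit Types V P Q : 'M['B(h)]_(1 + (ne + ni) + 1).

Lemma split_lshift m n (i : 'I_m) : fintype.split (lshift n i) = inl i.
Proof. exact: (unsplitK (inl i)). Qed.

Lemma split_rshift m n (i : 'I_n) : fintype.split (rshift m i) = inr i.
Proof. exact: (unsplitK (inr i)). Qed.

Lemma assemble_blk V : assemble (blk V) = mxsub xindex xindex V.
Proof.
apply/matrixP => i j; rewrite !mxE /xindex.
by case: (fintype.split i) => i'; rewrite !mxE;
  case: (fintype.split j) => j'; rewrite !mxE //;
  try (case: (fintype.split i') => i''; rewrite ?mxE);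
  try (case: (fintype.split j') => j''; rewrite ?mxE).
Qed.

Lemma Vi_E V : Vi_ V = mxsub iindex xindex V.
Proof.
apply/matrixP => i j; rewrite !mxE /xindex.
by case: (fintype.split j) => j'; rewrite !mxE //;
  case: (fintype.split j') => j''; rewrite !mxE.
Qed.

Lemma V_iE V : V_i V = mxsub xindex iindex V.
Proof.
apply/matrixP => i j; rewrite !mxE /xindex.
by case: (fintype.split i) => i'; rewrite !mxE //;
  case: (fintype.split i') => i''; rewrite !mxE.
Qed.

Lemma mxsub_mulmx m n (f : 'I_m -> 'I_(1 + (ne + ni) + 1))
    (g : 'I_n -> 'I_(1 + (ne + ni) + 1)) P Q :
  mxsub f g (P *m Q) = mxsub f xindex P *m mxsub xindex g Q +
    mxsub f iindex P *m mxsub iindex g Q.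
Proof.
apply/matrixP => i j; rewrite !mxE !big_split_ord/= -!addrA.
congr (_ + _).
  apply: eq_bigr => k _.
  by rewrite !mxE /xindex split_lshift split_lshift.
(* The remaining sums come in the order e, i, 0'; the internal one is moved to the end. *)
rewrite addrCA addrC addrA; congr (_ + _); last first.
  by apply: eq_bigr => k _; rewrite !mxE.
congr (_ + _); apply: eq_bigr => k _.
  by rewrite !mxE /xindex split_lshift split_rshift.
by rewrite !mxE /xindex split_rshift.
Qed.

(** J exchanges only 0 and 0' and fixes e and i, hence is block diagonal for this partition. *)
Lemma Jmx_split : [/\ mxsub xindex xindex (Jmx h (ne + ni)) = Jmx h ne,
  mxsub xindex iindex (Jmx h (ne + ni)) = 0,
  mxsub iindex xindex (Jmx h (ne + ni)) = 0 &
  mxsub iindex iindex (Jmx h (ne + ni)) = 1%:M].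
Proof.
pose rules := (split_lshift, split_rshift, eq_lshift, eq_rshift, eq_lrshift,
  eq_rlshift, @mxE).
split; apply/matrixP => i j.
- case: (split_ordP i) => i' ->; first case: (split_ordP i') => i'' ->;
    case: (split_ordP j) => j' ->; try case: (split_ordP j') => j'' ->;
    by rewrite !mxE /xindex !rules.
- case: (split_ordP i) => i' ->; first case: (split_ordP i') => i'' ->;
    by rewrite !mxE /xindex !rules.
- case: (split_ordP j) => j' ->; first case: (split_ordP j') => j'' ->;
    by rewrite !mxE /xindex !rules.
- by rewrite !mxE /= !rules.
Qed.

Lemma mxsub_Jmx m n (f : 'I_m -> 'I_(1 + (ne + ni) + 1))
    (g : 'I_n -> 'I_(1 + (ne + ni) + 1)) P Q :
  mxsub f g (P *m Jmx h (ne + ni) *m Q) =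
    mxsub f xindex P *m Jmx h ne *m mxsub xindex g Q +
    mxsub f iindex P *m mxsub iindex g Q.
Proof.
have [Jxx Jxi Jix Jii] := Jmx_split.
by rewrite !mxsub_mulmx Jxx Jxi Jix Jii !mulmx0 mulmx1 addr0 add0r.
Qed.

(** Used with [P = dagger V], [Q = V] for the first identity and with the roles exchanged for the
    second. The four block relations are the blocks of [P J Q = J]. *)
Lemma mxsub_transfer P Q (X Y M N : 'M['B(h)]_ni) :
  P *m Jmx h (ne + ni) *m Q = Jmx h (ne + ni) ->
  M *m (1%:M - X *m mxsub iindex iindex P) = 1%:M ->
  (1%:M - mxsub iindex iindex Q *m Y) *m N = 1%:M ->
  (mxsub xindex xindex P +
     mxsub xindex iindex P *m (M *m X) *m mxsub iindex xindex P) *m Jmx h ne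
    *m (mxsub xindex xindex Q +
     mxsub xindex iindex Q *m (Y *m N) *m mxsub iindex xindex Q) =
  Jmx h ne + mxsub xindex iindex P *m (M *m (X *m Y - 1%:M) *m N)
    *m mxsub iindex xindex Q.
Proof.
move=> PJQ MX YN; have [Jxx Jxi Jix Jii] := Jmx_split.
by apply: (transfer_identity (D := mxsub iindex iindex Q)
  (D' := mxsub iindex iindex P)); rewrite -?mxsub_Jmx ?PJQ.
Qed.

(** The blockwise corrections share their middle factor, so they assemble into one product of a
    column, that factor and a row. *)
Lemma PhiE V X N : is_inverse (1%:M - blk V labi labi *m scmx h X) N ->
  Phi V X = mxsub xindex xindex V +
    mxsub xindex iindex V *m (scmx h X *m N) *m mxsub iindex xindex V.
Proof.
move=> XN; rewrite /Phi (inverseE XN) -assemble_blk -Vi_E -V_iE.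
rewrite /Vi_ /V_i /assemble -!(mulmxA _ (scmx h X)).
rewrite 2!(mul_col_mx _ _ (scmx h X *m N)) 2!mul_col_row.
by rewrite !(mul_col_mx, mul_mx_row) !(add_block_mx, add_col_mx, add_row_mx).
Qed.

End Partition.

(** * The two product identities for the fractional map *)

Section FractionalMap.
Variables (R : realType) (h : hilbertType R) (ne ni : nat).
Variable V : 'M['B(h)]_(1 + (ne + ni) + 1).
Hypotheses
  (V_isometry : dagger V *m Jmx h (ne + ni) *m V = Jmx h (ne + ni))
  (V_coisometry : V *m Jmx h (ne + ni) *m dagger V = Jmx h (ne + ni)).

Let D := blk V labi labi.

Lemma invertible_dagger X :
  Phi_dom V X -> is_inverse (1%:M - scmx h (X^t*) *m dagger D)
    (dagger (inverse (1%:M - D *m scmx h X))).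
Proof.
case=> N XN; rewrite (inverseE XN).
by rewrite -dagger_scmx; exact: is_inverse_dagger_1B.
Qed.

Lemma invertible_swap X : Phi_dom V X ->
  exists2 M, is_inverse (1%:M - scmx h X *m D) M &
    M *m scmx h X = scmx h X *m inverse (1%:M - D *m scmx h X).
Proof.
case=> N XN; rewrite (inverseE XN); have [? ?] := is_inverse_swap XN.
by exists (1%:M + scmx h X *m N *m D).
Qed.

Lemma star_Phi_mul X Y : Phi_dom V X -> Phi_dom V Y ->
  star (Phi V X) *m Phi V Y = 1%:M + star_row (Vi_ V)
    *m inverse (1%:M - scmx h (X^t*) *m dagger D)
    *m scmx h (X^t* *m Y - 1%:M)
    *m inverse (1%:M - D *m scmx h Y) *m Vi_ V.
Proof.
move=> domX [NY YN]; have XM := invertible_dagger domX; case: domX => NX XN.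
rewrite (inverseE XN) in XM; rewrite (inverseE XM) (inverseE YN).
rewrite /star (PhiE XN) (PhiE YN) /star_row Vi_E.
rewrite daggerD !daggerM dagger_scmx !dagger_mxsub scmxB scmxM scmx1.
have := mxsub_transfer (M := dagger NX) (X := scmx h (X^t*)) (Y := scmx h Y)
  V_isometry _ YN.1.
rewrite -dagger_mxsub => /(_ XM.2); rewrite -!mulmxA => ->.
(* The outer J of the star turns the leading J into 1 and the dagger of the row into its star. *)
by rewrite mulmxDr Jmx_sqr.
Qed.

Lemma Phi_mul_star X Y : Phi_dom V X -> Phi_dom V Y ->
  Phi V X *m star (Phi V Y) = 1%:M + V_i V
    *m inverse (1%:M - scmx h X *m D)
    *m scmx h (X *m Y^t* - 1%:M)
    *m inverse (1%:M - dagger D *m scmx h (Y^t*)) *m star_col (V_i V).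
Proof.
move=> domX domY; have [MX XM XMX] := invertible_swap domX.
have [MY YM YMY] := invertible_swap domY.
have := is_inverse_dagger_1B YM; rewrite dagger_scmx => YMd.
rewrite (inverseE XM) (inverseE YMd).
case: domX domY => NX XN [NY YN]; rewrite (inverseE XN) in XMX.
rewrite (inverseE YN) in YMY.
(* Push-through rewrites both maps with [(1 - X D)^-1] to the left of [X]; the dagger then puts the
   inverse for [Y] on the right, as the transfer identity requires. *)
rewrite /star (PhiE XN) (PhiE YN) /star_col V_iE -XMX -YMY.
rewrite daggerD !daggerM dagger_scmx !dagger_mxsub scmxB scmxM scmx1.
have := mxsub_transfer (N := dagger MY) (X := scmx h X) (Y := scmx h (Y^t*))
  V_coisometry XM.2.
rewrite -(dagger_mxsub (bindex (a := labi)) (bindex (a := labi))) => /(_ YMd.1).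
rewrite !mulmxA => ->.
by rewrite mulmxDl Jmx_sqr.
Qed.

Lemma Phi_star_unitary X :
  Phi_dom V X -> X \is unitarymx -> star_unitary (Phi V X).
Proof.
move=> domX /unitarymxP XX; have XX' := mulmx1C XX.
rewrite /star_unitary Phi_mul_star// star_Phi_mul// XX XX' subrr scmx0.
by split; rewrite mulmx0 mul0mx mul0mx addr0.
Qed.

End FractionalMap.

(** The invertibility conjuncts, together with [Phi_dom V Y], certify that no [inverse] in the
    formulas takes its default value. *)
Theorem theorem4 (R : realType) (h : hilbertType R) (ne ni : nat)
    (ne_gt0 : (0 < ne)%N) (ni_gt0 : (0 < ni)%N)
    (S : 'M['B(h)]_(ne + ni)) (L : 'cV['B(h)]_(ne + ni)) (H : 'B(h))
    (S_unitary : unitary_op S) (H_selfadjoint : H = adj H) :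
  let V := Vmx S L H in
  let Vii := blk V labi labi in
  (forall X Y : 'M[R[i]]_ni, Phi_dom V X -> Phi_dom V Y ->
     [/\ invertible (1%:M - scmx h (X^t*) *m dagger Vii),
         star (Phi V X) *m Phi V Y =
           1%:M + star_row (Vi_ V)
             *m inverse (1%:M - scmx h (X^t*) *m dagger Vii)
             *m scmx h (X^t* *m Y - 1%:M)
             *m inverse (1%:M - Vii *m scmx h Y)
             *m Vi_ V,
         invertible (1%:M - scmx h X *m Vii),
         invertible (1%:M - dagger Vii *m scmx h (Y^t*))
       & Phi V X *m star (Phi V Y) =
           1%:M + V_i V
             *m inverse (1%:M - scmx h X *m Vii)
             *m scmx h (X *m Y^t* - 1%:M)
             *m inverse (1%:M - dagger Vii *m scmx h (Y^t*))
             *m star_col (V_i V)])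
  /\ (forall X : 'M[R[i]]_ni, Phi_dom V X -> X \is unitarymx ->
        star_unitary (Phi V X)).
Proof.
move=> V Vii.
have iso : dagger V *m Jmx h _ *m V = _ :=
  Vmx_isometry L S_unitary H_selfadjoint.
have coiso : V *m Jmx h _ *m dagger V = _ :=
  Vmx_coisometry L S_unitary H_selfadjoint.
split=> [X Y domX domY|X]; last exact: Phi_star_unitary.
split.
- by eexists; exact: invertible_dagger domX.
- exact: star_Phi_mul.
- by have [M ? _] := invertible_swap domX; exists M.
- have [M YM _] := invertible_swap domY; exists (dagger M).
  by rewrite -dagger_scmx; exact: is_inverse_dagger_1B.
- exact: Phi_mul_star.
Qed.
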